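(* There exists a $3$-uniform hypergraph $H_2$ with no isolated vertices which has no strongly minimal edge-cover.
   Context: A hypergraph $H$ consists of a (possibly infinite) vertex set $V$ and a set $E$ of edges, each a subset of $V$; it is $3$-uniform if every edge has exactly $3$ vertices. A vertex is isolated if it lies in no edge. An edge-cover is a set $C\subseteq E$ of edges whose union is $V$. An edge-cover $C$ is strongly minimal if for every edge-cover $C'$ of $H$ we have $|C\setminus C'|\leq |C'\setminus C|$ (comparison of cardinalities). *)

(* Defs.v *)
From mathcomp Require Import all_boot.
From mathcomp Require Import boolp classical_sets cardinality.

Set Implicit Arguments.
Unset Strict Implicit.
Unset Printing Implicit Defensive.

Local Open Scope classical_set_scope.
Local Open Scope card_scope.

Record hypergraph := Hypergraph {
  vertex : Type;
  edges : set (set vertex)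
}.
Arguments edges : clear implicits.

(* `I_k is the set of natural numbers below k; #= and #<= compare
   arbitrary, possibly infinite, cardinalities. *)
Definition uniform (k : nat) (H : hypergraph) : Prop :=
  forall e, edges H e -> e #= `I_k.

Definition isolated (H : hypergraph) (v : vertex H) : Prop :=
  ~ exists2 e, edges H e & e v.

Definition edge_cover (H : hypergraph) (C : set (set (vertex H))) : Prop :=
  C `<=` edges H /\ \bigcup_(e in C) e = [set: vertex H].

Definition strongly_minimal (H : hypergraph) (C : set (set (vertex H))) : Prop :=
  edge_cover C /\ forall C', edge_cover C' -> C `\` C' #<= C' `\` C.

(* Main.v *)
Require Import Defs.
From mathcomp Require Import all_boot zify.
From mathcomp Require Import finmap.
From mathcomp Require Import boolp classical_sets cardinality.

(**
Gadget [p] is a path [a_0 b_0 a_1 b_1 ...].  Its pairs [a_i b_i] can be covered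
by the "off" edges [{apex, a_i, b_i}], and for [i <= p] the pairs [b_i a_{i+1}]
can be covered by the "on" edges [{g_i, a_{i+1}, b_i}], which also meet one
ground vertex.  The ends of the path force [{apex, a_0, b_0}] and
[{apex, a_{p+1}, b_{p+1}}] into every cover, so switching the stretch between
two consecutive off edges of a cover to on costs exactly one additional edge.
A cover contains on edges in infinitely many gadgets, since gadget [p] reaches
only [g_0, ..., g_p].  Choose gadget [m] with an on edge at [g_0] and gadget
[n > m] with an on edge at [g_{m+1}]: switching [m] off entirely saves an edge,
and making [n] on at [g_0, ..., g_{m+1}], which keeps the ground covered, is
free.
*)

Set Implicit Arguments.
Unset Strict Implicit.
Unset Printing Implicit Defensive.

Local Open Scope classical_set_scope.
Local Open Scope card_scope.

(** With [b] added to the image of [A], the set [B] contains one element more than the finite [A].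
    Below, [A] is the set of added edges and [B] that of removed ones. *)
Lemma not_card_le_inj (T : choiceType) (A B : set T) (f : T -> T) (b : T) :
  finite_set A -> injective f -> f @` A `<=` B -> B b -> ~ (f @` A) b ->
  ~ (B #<= A).
Proof.
move=> [k Ak] injf fAB Bb fAb BA.
have fAk : f @` A #= `I_k.
  by rewrite (card_eql (inj_card_eq _)) // => x y _ _; apply: injf.
have fAfin : finite_set (f @` A) by exists k.
have Uk : b |` f @` A #= `I_k.+1.
  have Ufin : finite_set (b |` f @` A).
    by rewrite finite_setU; split => //; exact: finite_set1.
  rewrite -(fset_setK Ufin); apply/card_eq_fsetP.
  rewrite fset_setU1 // cardfsU1 (card_fset_set fAk) in_fset_set //.
  by rewrite memNset.
have : `I_k.+1 #<= `I_k.
  rewrite -(card_le_eql Uk) -(card_le_eqr Ak).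
  apply: card_le_trans BA; apply: subset_card_le => x [->//|]; exact: fAB.
by rewrite card_le_II ltnn.
Qed.

Lemma card_set3 (T : Type) (x y z : T) :
  x <> y -> x <> z -> y <> z -> [set x; y; z] #= `I_3.
Proof.
move=> xy xz yz; rewrite card_eq_sym.
pose f i := if i is i'.+1 then if i' is 0 then y else z else x.
have -> : [set x; y; z] = f @` `I_3.
  apply/seteqP; split => [t [[->|->]|->]|t [[|[|[|//]]] _ <-]] /=.
  - by exists 0.
  - by exists 1.
  - by exists 2.
  - by left; left.
  - by left; right.
  - by right.
rewrite card_eq_sym; apply: inj_card_eq.
by move=> [|[|[|i]]] [|[|[|j]]]; rewrite !inE //= => _ _ E; exfalso; auto.
Qed.

(** [lft p i] and [rgt p i] are a_i and b_i of gadget [p]; [apex] and the vertices [ground i] are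
    common to all gadgets. *)
Inductive point : Type :=
  | apex
  | ground of nat
  | lft of nat & nat
  | rgt of nat & nat.

(* The code [(on, p, i)] names the [i]-th on or off edge of gadget [p]. *)
Definition link (c : bool * nat * nat) : set point :=
  let: (on, p, i) := c in
  if on then [set ground i; lft p i.+1; rgt p i]
  else [set apex; lft p i; rgt p i].

Definition valid (c : bool * nat * nat) : bool :=
  let: (on, p, i) := c in on ==> (i <= p).

Definition gadgets : hypergraph :=
  @Hypergraph point [set link c | c in [set c | valid c]].

(** The only [rgt] vertex of an edge gives [p] and [i], and [apex] tells off from on. Covers can
    thus be treated as sets of codes. *)
Lemma link_inj : injective link.
Proof.
move=> [[[] p] i] [[[] q] j] /= E.
- have : [set ground j; lft q j.+1; rgt q j] (rgt p i) by rewrite -E; right.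
  by move=> [[//|//]|[-> ->]].
- have : [set apex; lft q j; rgt q j] (ground i) by rewrite -E; left; left.
  by move=> [[//|//]|//].
- have : [set ground j; lft q j.+1; rgt q j] apex by rewrite -E; left; left.
  by move=> [[//|//]|//].
- have : [set apex; lft q j; rgt q j] (rgt p i) by rewrite -E; right.
  by move=> [[//|//]|[-> ->]].
Qed.

Lemma gadgets_uniform : uniform 3 gadgets.
Proof. by move=> _ [[[[] p] i] _ <-]; apply: card_set3. Qed.

Lemma gadgets_not_isolated (x : vertex gadgets) : ~ isolated x.
Proof.
apply; case: x => [|i|p i|p i].
- by exists (link (false, 0, 0)); [exists (false, 0, 0) | left; left].
- exists (link (true, i, i)); last by left; left.
  by exists (true, i, i) => //=.
- by exists (link (false, p, i)); [exists (false, p, i) | left; right].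
- by exists (link (false, p, i)); [exists (false, p, i) | right].
Qed.

Lemma cover_valid P c : @edge_cover gadgets (link @` P) -> P c -> valid c.
Proof.
move=> [sub _] Pc.
by have [c' + /link_inj <-] : edges gadgets (link c) by apply: sub; exists c.
Qed.

Lemma cover_link P x :
  @edge_cover gadgets (link @` P) -> exists2 c, P c & link c x.
Proof.
move=> [_ cov].
have [_ [c Pc <-] cx] : (\bigcup_(e in link @` P) e) x by rewrite cov.
by exists c.
Qed.

Lemma cover_ground P i :
  @edge_cover gadgets (link @` P) -> exists2 p, i <= p & P (true, p, i).
Proof.
move=> covP; have [[[[] p] j] Pc /=] := cover_link (ground i) covP; last first.
  by move=> [[]|].
move=> [[[E]|//]|//]; rewrite E.
by exists p => //; exact: (cover_valid covP Pc).
Qed.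

Lemma cover_lft0 P p : @edge_cover gadgets (link @` P) -> P (false, p, 0).
Proof.
move=> covP; have [[[[] q] j] Pc /=] := cover_link (lft p 0) covP.
- by move=> [[]|].
- by move=> [[//|[-> ->]]|//].
Qed.

Lemma cover_lftS P p i :
  @edge_cover gadgets (link @` P) -> P (false, p, i.+1) \/ P (true, p, i).
Proof.
move=> covP; have [[[[] q] j] Pc /=] := cover_link (lft p i.+1) covP.
- by move=> [[//|[-> ->]]|//]; right.
- by move=> [[//|[-> ->]]|//]; left.
Qed.

Lemma cover_rgt P p i :
  @edge_cover gadgets (link @` P) -> P (false, p, i) \/ P (true, p, i).
Proof.
move=> covP; have [[[[] q] j] Pc /=] := cover_link (rgt p i) covP.
- by move=> [[//|//]|[-> ->]]; right.
- by move=> [[//|//]|[-> ->]]; left.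
Qed.

(** Off edge 0 of gadget [n] is kept because no other edge meets [lft n 0]. *)
Definition switch (P : set (bool * nat * nat)) (m n k : nat) :
    set (bool * nat * nat) :=
  [set c | let: (on, p, i) := c in
    if p == m then is_true (~~ on)
    else if (p == n) && (i <= k) then is_true (on || (i == 0))
    else P c].

Lemma switch_cover P m n k : m < k <= n -> @edge_cover gadgets (link @` P) ->
  @edge_cover gadgets (link @` switch P m n k).
Proof.
move=> /andP[mk kn] covP.
have nm : (n == m) = false by lia.
split=> [_ [[[on p] i] Q <-]|].
  exists (on, p, i) => //; move: Q; rewrite /switch /=.
  case: eqP => [_|_]; first by case: on.
  case: ifP => [/andP[/eqP-> ik] _|_ /(cover_valid covP)//].
  by rewrite (leq_trans ik kn) implybT.
apply/seteqP; split=> // x _.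
suff [c Qc cx] : exists2 c, switch P m n k c & link c x.
  by exists (link c) => //; exists c.
case: x => [|i|p i|p i].
- by exists (false, m, 0); [rewrite /switch /= eqxx | left; left].
- have [ik|ki] := leqP i k.
    by exists (true, n, i); [rewrite /switch /= nm eqxx ik | left; left].
  have [p ip Pp] := cover_ground i covP.
  (* This edge survives the switch: [m < k < i <= p] excludes [p = m]. *)
  exists (true, p, i); last by left; left.
  by rewrite /switch /= ifN ?ifN //; lia.
- have [->|pm] := eqVneq p m.
    by exists (false, m, i); [rewrite /switch /= eqxx | left; right].
  case: i => [|i].
    exists (false, p, 0); last by left; right.
    by rewrite /switch /= (negbTE pm); case: ifP => // _; exact: cover_lft0.
  have [/andP[/eqP-> ik]|npi] := boolP ((p == n) && (i <= k)).
    by exists (true, n, i); [rewrite /switch /= nm eqxx ik | left; right].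
  case: (cover_lftS p i covP) => Pc.
  + exists (false, p, i.+1); last by left; right.
    by rewrite /switch /= (negbTE pm) ifN //; lia.
  + exists (true, p, i); last by left; right.
    by rewrite /switch /= (negbTE pm) ifN.
- have [->|pm] := eqVneq p m.
    by exists (false, m, i); [rewrite /switch /= eqxx | right].
  have [/andP[/eqP-> ik]|npi] := boolP ((p == n) && (i <= k)).
    by exists (true, n, i); [rewrite /switch /= nm eqxx ik | right].
  case: (cover_rgt p i covP) => Pc.
  + by exists (false, p, i); [rewrite /switch /= (negbTE pm) ifN | right].
  + by exists (true, p, i); [rewrite /switch /= (negbTE pm) ifN | right].
Qed.

(* On the codes that [switch] adds, [partner] is the removed edge paid for it:
   the off edge [i] of gadget [m] replaces the on edge [i], and the on edge [i]
   of gadget [n] replaces the off edge [i.+1]. *)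
Definition partner (c : bool * nat * nat) : bool * nat * nat :=
  let: (on, p, i) := c in (~~ on, p, i + on).

Lemma partner_inj : injective partner.
Proof.
move=> [[a p] i] [[b q] j] [/(can_inj negbK) -> ->] /eqP.
by rewrite eqn_add2r => /eqP ->.
Qed.

(** An added edge shares a path vertex with its partner, and no third edge meets that vertex, so [P]
    had to contain the partner. *)
Lemma partner_switch P m n k : @edge_cover gadgets (link @` P) ->
  P (true, n, k) -> partner @` (switch P m n k `\` P) `<=` P `\` switch P m n k.
Proof.
move=> covP Pnk _ [[[on p] i] [+ nP] <-]; rewrite /partner /switch /=.
case: eqP => [E | /eqP pm]; first subst p.
  case: on nP => // nP _; rewrite addn0; split=> //.
  by case: (cover_rgt m i covP).
case: ifP => [/andP[/eqP E ik]|//]; subst p.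
case: on nP => [nP _|nP /= /eqP i0]; last first.
  by case: nP; rewrite i0; exact: cover_lft0.
(* On edge [k] is already in [P], so off edge [i.+1] still lies in the switched range. *)
have {}ik : i < k.
  by rewrite ltn_neqAle ik andbT; apply/eqP => E; apply: nP; rewrite E.
rewrite addn1; split; first by case: (cover_lftS n i covP).
by rewrite eqxx ik.
Qed.

(** Each off edge added in gadget [m] replaces an on edge, whose index is at most [m]. *)
Lemma switch_finite P m n k : @edge_cover gadgets (link @` P) ->
  finite_set (switch P m n k `\` P).
Proof.
move=> covP.
apply: (@sub_finite_set _ _
  (([set: bool] `*` [set m; n]) `*` `I_((maxn m k).+1))); last first.
  apply: finite_setX; last exact: finite_II.
  by apply: finite_setX; [exact: finite_finset | exact: finite_set2].
move=> [[on p] i] [+ nP]; rewrite /switch /=.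
case: eqP => [E | /eqP pm]; first subst p.
  case: on nP => // nP _; split; first by split=> //; left.
  have [//|/(cover_valid covP) /= im] := cover_rgt m i covP.
  by rewrite ltnS leq_max im.
case: ifP => [/andP[/eqP-> ik] _|//].
by split; [split=> //; right | rewrite ltnS leq_max ik orbT].
Qed.

Lemma gadgets_not_strongly_minimal C : ~ @strongly_minimal gadgets C.
Proof.
move=> [covC minC].
pose P := link @^-1` C.
have EC : C = link @` P.
  apply/seteqP; split=> [e Ce|_ [c Pc <-] //].
  case: covC => /(_ e Ce) [c _ E] _.
  by exists c => //; rewrite /P /= E.
rewrite EC in covC minC; move: {C} P {EC} covC minC => P covP minP.
have [m _ Pm] := cover_ground 0 covP.
(* Asking for [g_{m+1}] forces [n > m]; then [k = m.+1] has its on edge in [P]. *)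
have [n mn Pn] := cover_ground m.+1 covP.
have := minP _ (switch_cover (m := m) (n := n) (k := m.+1) _ covP).
rewrite mn ltnSn => /(_ isT).
have imD (A B : set (bool * nat * nat)) :
    link @` A `\` link @` B = link @` (A `\` B).
  apply/seteqP; split=> [_ [[c Ac <-] nB]|_ [c [Ac nB] <-]].
    by exists c => //; split=> // Bc; apply: nB; exists c.
  by split; [exists c | move=> [c' Bc' /link_inj E]; apply: nB; rewrite -E].
rewrite !imD (card_le_eql (inj_card_eq _)); last first.
  by move=> ? ? _ _; exact: link_inj.
rewrite (card_le_eqr (inj_card_eq _)); last by move=> ? ? _ _; exact: link_inj.
apply: (not_card_le_inj (f := partner) (b := (true, m, 0))).
- exact: switch_finite.
- exact: partner_inj.
- exact: partner_switch.
- by split=> //; rewrite /switch /= eqxx.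
(* Only off edge 0 of gadget [m] has this partner, and it is in every cover, hence never added. *)
- move=> [[[[] p] i] [Q nP] //= [E F]]; apply: nP.
  by rewrite E -[i]addn0 F; exact: cover_lft0.
Qed.

Theorem theorem1p3 :
  exists H : hypergraph,
    uniform 3 H /\
    (~ exists v : vertex H, isolated v) /\
    ~ exists C, @strongly_minimal H C.
Proof.
exists gadgets; split; first exact: gadgets_uniform.
split; first by move=> [x]; exact: gadgets_not_isolated.
by move=> [C]; exact: gadgets_not_strongly_minimal.
Qed.
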